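(* Let $b\ge 2$ and $k\ge 1$ be integers, and write $b=p_1^{l_1}\cdots p_r^{l_r}$ with $p_1,\dots,p_r$ distinct primes and $l_1,\dots,l_r$ positive integers. If $r\ge 2$, assume the primes are numbered so that $$l_1(p_1-1)\ge l_2(p_2-1)\ge\cdots\ge l_r(p_r-1)\quad\text{and}\quad p_1=\max\{p_i : l_i(p_i-1)=l_1(p_1-1)\}.$$ Let $a\in\{1,\dots,b^k-1\}$ be such that $b\nmid a$. Then the asymptotic density $f_{b,k}(a)$ of the set $\{n\ge 0:\ell_{b,k}(n!)=a\}$ exists, and $$f_{b,k}(a)=\frac{1}{(p_1-1)l_1}\,p_1^{\nu_{p_1}(a)-kl_1+1}$$ if $(b/p_1^{l_1})^k\mid a$, while $f_{b,k}(a)=0$ otherwise. Moreover, for any integers $c\ge 1$ and $d\ge 0$, the number $a$ appears in the subsequence $\{\ell_{b,k}((cn+d)!)\}_{n\ge 0}$ with asymptotic frequency $f_{b,k}(a)$, regardless of $c$ and $d$; that is, the set $\{n\ge 0:\ell_{b,k}((cn+d)!)=a\}$ has asymptotic density $f_{b,k}(a)$.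
   Context: For positive integers $m$ and $c\ge 2$, $\nu_c(m)$ denotes the largest integer $l$ such that $c^l\mid m$ ($c$ need not be prime), and $m \bmod c$ denotes the residue of $m$ modulo $c$ in $\{0,\dots,c-1\}$. For integers $b\ge 2$, $k\ge 1$, define $\ell_{b,k}(m)=\frac{m}{b^{\nu_b(m)}}\bmod b^k$ (the number formed by the $k$ last nonzero base-$b$ digits of $m$). The asymptotic density of a set $A\subset\mathbb{N}$ is $\lim_{n\to\infty}|A\cap\{1,\dots,n\}|/n$, if it exists. The asymptotic frequency of a value in a sequence is the asymptotic density of the set of indices at which the value occurs. *)

(* Defs.v *)
From HB Require Import structures.
From mathcomp Require Import all_boot all_order all_algebra.
From mathcomp Require Import classical_sets reals topology normedtype.

Set Implicit Arguments.
Unset Strict Implicit.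
Unset Printing Implicit Defensive.

Import Order.TTheory GRing.Theory Num.Theory.
Import numFieldNormedType.Exports.

Local Open Scope classical_set_scope.
Local Open Scope ring_scope.

(* [logn] is only meaningful at primes, whereas here [c] may be composite.
   For [1 < c] and [0 < m], [c ^ l %| m] forces [l < m], so bounding the
   index by [m] loses nothing; see [nuP]. *)
Definition nu (c m : nat) : nat := (\max_(l < m | c ^ l %| m) l)%N.

Lemma nuP (c m l : nat) : (1 < c)%N -> (0 < m)%N ->
  (c ^ l %| m)%N = (l <= nu c m)%N.
Proof.
move=> c1 m0; apply/idP/idP => [clm | lnu].
  have lm : (l < m)%N.
    by apply: leq_trans (dvdn_leq m0 clm); exact: ltn_expl.
  exact: (@leq_bigmax_cond _ (fun i : 'I_m => (c ^ i %| m)%N)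
    (fun i : 'I_m => i : nat) (Ordinal lm)).
have [i ci nui] : {i : 'I_m | (c ^ i %| m)%N & nu c m = i}.
  by apply: eq_bigmax_cond; apply/card_gt0P; exists (Ordinal m0);
    exact: dvd1n.
by rewrite nui in lnu; exact: dvdn_trans (dvdn_exp2l c lnu) ci.
Qed.

Definition ell (b k m : nat) : nat := ((m %/ b ^ nu b m) %% b ^ k)%N.

(* The quotient at [n = 0] is the junk value [0 / 0 = 0], irrelevant to the
   limit. *)
Definition has_density (R : realType) (A : {pred nat}) (x : R) : Prop :=
  (count [in A] (iota 1 n))%:R / n%:R @[n --> \oo] --> x.

(* Main.v *)
Require Import Defs.
From HB Require Import structures.
From mathcomp Require Import all_boot all_order all_algebra.
From mathcomp Require Import all_fingroup all_solvable.
From mathcomp Require Import classical_sets reals topology normedtype.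
From mathcomp Require Import zify ring lra.

Set Implicit Arguments.
Unset Strict Implicit.
Unset Printing Implicit Defensive.

Import Order.TTheory GRing.Theory Num.Theory.
Import numFieldNormedType.Exports.

(** Let P be the distinguished prime, L its exponent in b, and m = b / P^L.

    Since (p-1) v_p(n!) = n - s_p(n), where s_p is the base p digit sum, the
    quantity v_p(n!) / l_p is governed by l_p (p-1): the prime with the largest
    l_p (p-1) is the one that limits the power of b dividing n!.  Against a
    prime with a strictly smaller l_p (p-1) it wins by a linear margin.  In
    case of a tie the digit sums decide: s_p(n) is close to (p-1)/2 times the
    number of base p digits of n for almost all n (Chebyshev's inequality), and
    (p-1)/log p increases with p, so the largest prime wins, by a margin that
    tends to infinity outside a set of density zero
    ([legendre_race_negligible]).  Hence, for almost all n,
    v_b(n!) = v_P(n!) / L rounded down, and n! / b^(v_b(n!)) is divisible by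
    m^k.  What remains of the last k nonzero digits is a residue modulo
    P^(kL), and it depends only on the image of n! in a finite quotient of the
    multiplicative group of the P-adic numbers ([ell_eqE], [mem_ell_classes]).

    The heart of the proof is [fact_equidistributed]: the image phi(n!) of n!
    in any finite quotient G of that group is equidistributed, also along
    every arithmetic progression.  Write n in base p.  When a block of digits
    y is a multiple of a suitable integer C, and is surrounded by enough
    zeros, it contributes to phi(n!) the factor phi(y!) and nothing else
    ([phi_fact_insert]), and it does not change n modulo c.  Every element of
    G is phi(y!) for some multiple y of C ([phi_fact_mult_surj]).  So there are
    |G| interchangeable blocks, one for each element of G.  Almost every n
    contains one of them at one of many fixed positions, and letting this block
    run through all of them makes phi(n!) run through G exactly once, whatever
    the other digits are ([block_sum_indep]).

    It remains to count the classes that give the digits a: these form the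
    proportion P^(v_P(a)) / (L phi(P^(kL))) of the group, with phi here Euler's
    function ([card_ell_classes]).  Densities are handled as inequalities
    between natural numbers up to the last step. *)

Local Open Scope nat_scope.

(** * Preliminaries on powers and sums *)

(** Bernoulli's inequality (1 + 1/x)^J >= 1 + J/x with J = e x, cleared of
    denominators. *)
Lemma expn_dominates (e x y : nat) : x < y -> exists J, e * x ^ J <= y ^ J.
Proof.
case: x => [|x] xy; first by exists 1; rewrite muln0.
suff H J : (x.+1 + J) * x.+1 ^ J <= x.+1 * x.+2 ^ J.
  exists (e * x.+1); apply: (@leq_trans (x.+2 ^ (e * x.+1))); last first.
    by case: (e * _) => // J; rewrite leq_exp2r.
  have := H (e * x.+1); rewrite -mulSn mulnAC mulnC leq_pmul2l //.
  by apply: leq_trans; rewrite leq_mul2r leqnSn orbT.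
elim: J => [|J IHJ]; first by rewrite addn0.
apply: (@leq_trans ((x.+1 + J) * x.+1 ^ J * x.+2)).
  by rewrite expnS mulnCA [X in _ <= X]mulnAC mulnA leq_mul2r; apply/orP; right; nia.
by rewrite expnSr mulnA leq_mul2r IHJ orbT.
Qed.

Lemma big_nat_mul_ord (T : Type) (idx : T) (op : Monoid.com_law idx) (m n : nat)
    (f : nat -> T) :
  \big[op/idx]_(0 <= w < m * n) f w =
  \big[op/idx]_(y < n) \big[op/idx]_(0 <= i < m) f (i * n + y).
Proof.
rewrite big_nat_mul exchange_big /=; apply: eq_bigr => i _.
rewrite mulSn -{1}[i * n]add0n big_addn addnK big_mkord.
by apply: eq_bigr => y _; rewrite addnC.
Qed.

Lemma sum_nat_residue (N c d : nat) (g : nat -> nat) : d < c ->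
  \sum_(0 <= w < N * c) (w %% c == d) * g w = \sum_(0 <= n < N) g (n * c + d).
Proof.
move=> dc; rewrite big_nat_mul_ord exchange_big /=; apply: eq_bigr => i _.
rewrite (bigD1 (Ordinal dc)) //= modnMDl modn_small // eqxx mul1n.
rewrite big1 ?addn0 // => y; rewrite -val_eqE /= => /negbTE yd.
by rewrite modnMDl modn_small ?yd.
Qed.

Lemma eqn_modM_coprime q c x y : coprime q c ->
  (c * x == c * y %[mod q]) = (x == y %[mod q]).
Proof.
move=> qc; wlog xy : x y / x <= y => [th|].
  have [xy | /ltnW yx] := leqP x y; first exact: th.
  by rewrite eq_sym [RHS]eq_sym; exact: th.
rewrite eq_sym [RHS]eq_sym !eqn_mod_dvd ?leq_mul2l ?xy ?orbT //.
by rewrite -mulnBr Gauss_dvdr.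
Qed.

Lemma pow_part_mul p n : 0 < n -> p ^ logn p n * n`_p^' = n.
Proof. by move=> n0; rewrite -p_part partnC. Qed.

Lemma coprime_part p n : prime p -> coprime p n`_p^'.
Proof. by move=> pp; rewrite prime_coprime // -p'natE // part_pnat. Qed.

(** * Equidistribution of factorials in finite quotients of the p-adic group *)

Section FactorialImages.
(** [phi] stands for the restriction to the positive integers of a homomorphism
    from the multiplicative group of Q_p onto a finite abelian group, trivial on
    1 + p^K Z_p.  Hypothesis [phi_mod] expresses this triviality inside the
    integers: when p^t does not divide x, a congruence between x and y modulo
    p^(t+K) forces y / x into 1 + p^K Z_p. *)
Variables (gT : finGroupType) (p K : nat) (phi : nat -> gT).
Hypothesis mulC : forall g h : gT, (g * h = h * g)%g.
Hypothesis p_gt1 : 1 < p.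
Hypothesis phiM :
  forall x y, 0 < x -> 0 < y -> (phi (x * y) = phi x * phi y)%g.
Hypothesis phi_mod : forall t x y, 0 < x -> 0 < y -> ~~ (p ^ t %| x) ->
  x = y %[mod p ^ (t + K)] -> phi x = phi y.
Hypothesis phi_surj : forall h : gT, exists2 v, 0 < v & phi v = h.

Local Notation F n := (phi n`!).

Lemma phi_fact0 : F 0 = 1%g.
Proof.
by apply: (mulgI (phi 1)); rewrite mulg1 -phiM.
Qed.

Lemma phi_factD x y :
  F (x + y) = (F x * \prod_(0 <= i < y) phi (x + i.+1))%g.
Proof.
elim: y => [|y IHy]; first by rewrite big_geq // mulg1 addn0.
by rewrite addnS factS phiM ?fact_gt0 // big_nat_recr //= mulgA -IHy mulC addnS.
Qed.

(** The K zero digits between x and y keep them apart: for 0 < i <= y the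
    quotient (x + i) / i belongs to 1 + p^K Z_p. *)
Lemma phi_factD_low t x y :
  p ^ (t + K) %| x -> y < p ^ t -> F (x + y) = (F x * F y)%g.
Proof.
move=> px ylt; have := phi_factD 0 y; rewrite add0n phi_fact0 mul1g => ->.
rewrite phi_factD.
congr (_ * _)%g; apply: eq_big_nat => i /andP[_ iy].
apply: (@phi_mod t); rewrite ?addn_gt0 ?orbT //.
  rewrite dvdn_addr; last by apply: dvdn_trans px; apply: dvdn_exp2l; lia.
  by rewrite gtnNdvd //; exact: leq_ltn_trans ylt.
by rewrite -modnDml (eqP px).
Qed.

(** Among the factors of (p^t x)!, the multiples of p^t contribute
    phi(x!) phi(p^t)^x.  The discrepancy [kappa] also collects the other
    factors, which come in x windows of p^t - 1 consecutive integers. *)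
Local Definition kappa1 t j :=
  (\prod_(0 <= i < (p ^ t).-1) phi (p ^ t * j + i.+1) * phi (p ^ t))%g.
Local Definition kappa t x := (\prod_(0 <= j < x) kappa1 t j)%g.

Lemma phi_fact_pmul t x : F (p ^ t * x) = (F x * kappa t x)%g.
Proof.
have pt0 : 0 < p ^ t by rewrite expn_gt0; lia.
rewrite /kappa; elim: x => [|x IHx]; first by rewrite muln0 big_geq // mulg1.
rewrite mulnS addnC -[X in _ + X](prednK pt0) phi_factD big_nat_recr //= IHx.
rewrite prednK // [_ + p ^ t]addnC -mulnS [phi (_ * _)]phiM //.
rewrite big_nat_recr //= factS phiM ?fact_gt0 // /kappa1.
rewrite [(phi x.+1 * _)%g]mulC -!mulgA; congr (_ * _)%g.
rewrite [RHS]mulC -!mulgA; congr (_ * (_ * _))%g; exact: mulC.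
Qed.

Lemma prod_periodic (f : nat -> gT) P x m : (forall i, f (i + P) = f i) ->
  (\prod_(0 <= i < P * m) f (x + i) = (\prod_(0 <= i < P) f (x + i)) ^+ m)%g.
Proof.
move=> fP; have fPm i n : f (i + P * n) = f i.
  by elim: n => [|n IHn]; rewrite ?muln0 ?addn0 // mulnS addnCA addnC fP.
elim: m => [|m IHm]; first by rewrite muln0 big_geq.
rewrite mulnS addnC (@big_cat_nat _ _ _ (P * m)) ?leq_addr //= IHm expgSr.
congr (_ * _)%g; rewrite -{1}[P * m]add0n [_ + P]addnC big_addn addnK.
by apply: eq_bigr => i _; rewrite addnA fPm.
Qed.

(** The factor [kappa1 t j] depends only on j modulo p^K, so a run of
    p^K #|gT| consecutive factors is a #|gT|-th power. *)
Lemma kappa_period t x m : kappa t (x + p ^ K * #|gT| * m) = kappa t x.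
Proof.
rewrite /kappa (@big_cat_nat _ _ _ x) ?leq_addr //= -{2}[x]add0n.
rewrite [x + _]addnC big_addn addnK; under [X in (_ * X)%g]eq_bigr do rewrite addnC.
rewrite -mulnA prod_periodic => [|j].
  by rewrite expgM -cardsT expg_cardG ?inE // expg1n mulg1.
rewrite /kappa1; congr (_ * _)%g; apply: eq_big_nat => i /andP[_ ilt].
apply: (@phi_mod t); rewrite ?addn_gt0 ?orbT //.
  rewrite dvdn_addr ?dvdn_mulr // gtnNdvd //; lia.
by rewrite mulnDr -expnD addnAC modnDr.
Qed.

Variable c : nat.
Hypothesis c_gt0 : 0 < c.
(** Adding a multiple of C to a number neither changes its residue modulo c nor
    its [kappa], and the multiple itself ends with K zero digits. *)
Let C := p ^ K * #|gT| * c.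

(** The digit block y sits between the low digits z and the high digits x.  It
    starts with K zeros because p^K divides x while y < p^s, and it ends with K
    zeros because C divides y; so it interacts with neither neighbour, and
    [kappa], the only other place where it could matter, does not see it. *)
Lemma phi_fact_insert t s x y z : C %| y -> y < p ^ s -> p ^ K %| x ->
  z < p ^ t ->
  F (p ^ t * (p ^ s * x + y) + z) = (F (p ^ (t + s) * x + z) * F y)%g.
Proof.
move=> /dvdnP[m ym] ylt px zlt.
have py : p ^ K %| y by rewrite ym /C -!mulnA dvdn_mull // dvdn_mulr.
rewrite [LHS](@phi_factD_low t) //; last first.
  by rewrite expnD dvdn_mul // dvdn_add // dvdn_mull.
rewrite [in RHS](@phi_factD_low t) //; last first.
  by rewrite [in X in _ %| X]expnD -mulnA expnD dvdn_mul // dvdn_mull.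
rewrite [in RHS]expnD -[in RHS]mulnA !phi_fact_pmul.
rewrite (@phi_factD_low s) ?expnD ?dvdn_mul // [X in kappa _ (_ + X)]ym.
rewrite (_ : m * C = p ^ K * #|gT| * (c * m)) ?kappa_period; last first.
  by rewrite mulnC mulnA.
rewrite -!phi_fact_pmul.
rewrite [F (p ^ t * _)]phi_fact_pmul -!mulgA; congr (_ * _)%g.
by rewrite mulC -mulgA.
Qed.

Let reached h := exists2 y, C %| y & F y = h.

Let ltC y : exists s, y < p ^ s.
Proof. by exists y; exact: ltn_expl. Qed.

(* Concatenating two blocks multiplies their images. *)
Let reachedM g h : reached g -> reached h -> reached (g * h)%g.
Proof.
move=> [y Cy <-] [z Cz <-]; have [s ys] := ltC y; have [t zt] := ltC z.
exists (p ^ t * (p ^ s * 0 + y) + z); first by rewrite muln0 dvdn_add ?dvdn_mull.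
by rewrite phi_fact_insert // muln0 add0n mulC.
Qed.

Let reachedV g : reached g -> reached g^-1%g.
Proof.
move=> rg; have rX n : reached (g ^+ n)%g.
  elim: n => [|n IHn]; last by rewrite expgS; exact: reachedM.
  by exists 0 => //; exact: phi_fact0.
rewrite [X in reached X](_ : _ = g ^+ #|gT|.-1)%g //; apply/eqP.
rewrite eq_invg_mul -expgS prednK; last by apply/card_gt0P; exists g.
by rewrite -cardsT expg_cardG ?inE.
Qed.

(** The reached elements form a subgroup by [phi_fact_insert].  It contains the
    quotient of the images of (C q v)! and (C q v - C)!, where q = p^(T+K) and
    C < p^T: this quotient is the product of phi over the window
    [C q v - C + 1, C q v].  Every entry of the window but the last keeps the
    same image for all v, as v changes it by a multiple of q while p^T does
    not divide it; the last one contributes phi(C q) phi(v).  As v varies,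
    everything is reached. *)
Lemma phi_fact_mult_surj h : exists2 y, C %| y & F y = h.
Proof.
have C0 : 0 < C.
  rewrite /C !muln_gt0 expn_gt0 c_gt0 andbT; apply/andP; split; first by lia.
  by apply/card_gt0P; exists h.
have [T CT] := ltC C; set q := p ^ (T + K).
have q0 : 0 < q by rewrite expn_gt0; lia.
pose A := (\prod_(0 <= i < C.-1) phi (C * q - C + i.+1) * phi (C * q))%g.
have prodC (f : nat -> gT) :
    (\prod_(0 <= i < C) f i = \prod_(0 <= i < C.-1) f i * f C.-1)%g.
  by rewrite -{1}(prednK C0) big_nat_recr.
have ratio v : 0 < v -> reached (A * phi v)%g.
  move=> v0; have CqC : C <= C * q * v by rewrite -mulnA leq_pmulr ?muln_gt0 ?q0.
  have -> : (A * phi v = (F (C * q * v - C))^-1 * F (C * q * v))%g.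
    rewrite -[in X in (_^-1 * X)%g](subnK CqC) phi_factD mulKg.
    rewrite prodC prednK // subnK // [phi (_ * v)]phiM //;
      last by rewrite muln_gt0 C0.
    rewrite /A ?mulgA; congr (_ * _ * _)%g; apply: eq_big_nat => i /andP[_ ilt].
    have CqC1 : C <= C * q by rewrite leq_pmulr.
    apply: (@phi_mod T); rewrite ?addn_gt0 ?orbT //.
      apply/negP => Td; have: p ^ T %| C * q.
        by rewrite dvdn_mull // dvdn_exp2l // leq_addr.
      rewrite -{1}(subnK CqC1).
      rewrite (_ : _ + C = C * q - C + i.+1 + (C - i.+1)); last by lia.
      rewrite dvdn_addr // => /dvdn_leq; lia.
    apply/eqP; rewrite -(eqn_modDr (C - i.+1)) -/q.
    rewrite (_ : C * q - C + i.+1 + (C - i.+1) = C * q); last by lia.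
    rewrite (_ : C * q * v - C + i.+1 + (C - i.+1) = C * v * q); last by nia.
    by rewrite !modnMl.
  apply: reachedM; last by exists (C * q * v); rewrite // -mulnA dvdn_mulr.
  apply: reachedV; exists (C * q * v - C) => //.
  by rewrite dvdn_sub // -mulnA dvdn_mulr.
have [v v0 <-] := phi_surj h.
have [w w0 phiw1] := phi_surj 1%g.
have rA : reached A by have := ratio _ w0; rewrite phiw1 mulg1.
by have := reachedM (reachedV rA) (ratio _ v0); rewrite mulKg.
Qed.

(** The J blocks of w, its base Q digits, are examined from the lowest to the
    highest.  If the current block is one of the Y h, then the numbers that
    differ from the present one only by having another Y g there realize each
    value of [F] exactly once, and they all have the same weight: together they
    contribute an amount that does not depend on h.  Otherwise the block joins
    the low digits z and the next one is examined.  Only the (Q - #|gT|)^J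
    numbers none of whose blocks is a Y h escape this argument. *)
Lemma block_sum_indep s (omega : nat -> nat) (Y : gT -> 'I_(p ^ (s + K))) :
    (forall n, omega n <= 1) -> (forall n m, omega (n + C * m) = omega n) ->
    (forall h, C %| Y h) -> (forall h, Y h < p ^ s) -> (forall h, F (Y h) = h) ->
  let Q := p ^ (s + K) in
  forall J t z x, z < p ^ t -> exists a, forall h,
    a <= \sum_(0 <= w < Q ^ J) omega (p ^ t * (Q ^ J * x + w) + z)
                              * (F (p ^ t * (Q ^ J * x + w) + z) == h)
      <= a + (Q - #|gT|) ^ J.
Proof.
move=> om1 omC CY Ys FY Q.
have injY : injective Y.
  by move=> g h /(congr1 (fun y : 'I_Q => F y)); rewrite !FY.
elim=> [|J IHJ] t z x zt.
  exists 0 => h; rewrite expn0 big_nat1 add0n expn0 /=.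
  by apply: leq_trans (om1 _);
    apply: leq_trans (leq_mul (leqnn _) (leq_b1 _)) _; rewrite muln1.
have ztQ (y : 'I_Q) : p ^ t * y + z < p ^ (t + (s + K)).
  have := ltn_ord y; rewrite expnD -/Q => yQ.
  apply: (@leq_trans (p ^ t * y.+1)); first by rewrite mulnS addnC ltn_add2r.
  by rewrite leq_mul2l yQ orbT.
have [a Ha] := fin_all_exists (fun y : 'I_Q => IHJ _ _ x (ztQ y)).
pose imY := [set Y h | h in [set: gT]].
pose b := \sum_(0 <= w < Q ^ J) omega (p ^ (t + (s + K)) * (Q ^ J * x + w) + z).
pose B := \sum_(y in ~: imY) a y.
exists (b + B) => h.
have -> : \sum_(0 <= w < Q ^ J.+1) omega (p ^ t * (Q ^ J.+1 * x + w) + z)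
              * (F (p ^ t * (Q ^ J.+1 * x + w) + z) == h) =
    \sum_(y < Q) \sum_(0 <= w < Q ^ J)
      omega (p ^ (t + (s + K)) * (Q ^ J * x + w) + (p ^ t * y + z)) *
      (F (p ^ (t + (s + K)) * (Q ^ J * x + w) + (p ^ t * y + z)) == h).
  rewrite [Q ^ J.+1]expnSr big_nat_mul_ord.
  apply: eq_bigr => y _; apply: eq_bigr => w _.
  rewrite (_ : p ^ t * (Q ^ J * Q * x + (w * Q + y)) + z =
    p ^ (t + (s + K)) * (Q ^ J * x + w) + (p ^ t * y + z)) //.
  by rewrite expnD -/Q; nia.
rewrite (bigID (fun y => y \in imY)) /=.
have -> : \sum_(y in imY) \sum_(0 <= w < Q ^ J)
      omega (p ^ (t + (s + K)) * (Q ^ J * x + w) + (p ^ t * y + z)) *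
      (F (p ^ (t + (s + K)) * (Q ^ J * x + w) + (p ^ t * y + z)) == h) = b.
  rewrite /imY big_imset /=; last by move=> ? ? _ _; exact: injY.
  rewrite exchange_big /=; apply: eq_bigr => w _.
  set n0 := p ^ (t + (s + K)) * (Q ^ J * x + w) + z.
  under eq_bigr => g _.
    have -> : F (p ^ (t + (s + K)) * (Q ^ J * x + w) + (p ^ t * Y g + z)) =
              (F n0 * g)%g.
      move: (Ys g) (CY g) (FY g); move: (nat_of_ord (Y g)) => y ys Cy <-.
      rewrite /n0 addnA expnD [p ^ (s + K)]expnD -!mulnA -mulnDr.
      rewrite phi_fact_insert ?dvdn_mulr //.
      by rewrite expnD !mulnA.
    have -> : omega (p ^ (t + (s + K)) * (Q ^ J * x + w) + (p ^ t * Y g + z)) =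
              omega n0.
      have /dvdnP[m ->] := CY g; rewrite -(omC n0 (p ^ t * m)); congr omega.
      by rewrite /n0; lia.
    over.
  rewrite -big_distrr /= (bigD1 ((F n0)^-1 * h)%g) ?inE //= mulKVg eqxx.
  rewrite big1 ?addn0 ?muln1 // => g /andP[_ /negbTE gn].
  by rewrite -(inj_eq (mulgI (F n0)^-1%g)) mulKg gn.
rewrite -addnA !leq_add2l.
have cimY : #|~: imY| = Q - #|gT|.
  by rewrite cardsCs finset.setCK card_imset // cardsT card_ord.
rewrite (eq_bigl (fun y => y \in ~: imY)) => [|y]; last by rewrite inE.
rewrite /B; apply/andP; split; first by apply: leq_sum => y _; case/andP: (Ha y h).
rewrite expnS -{1}cimY -sum_nat_const -big_split /=.
by apply: leq_sum => y _; case/andP: (Ha y h).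
Qed.

(** The interval [0, N) is cut into runs of Q^J numbers, to which
    [block_sum_indep] applies, with J so large that the proportion
    (1 - #|gT| / Q)^J of uncontrolled numbers is at most 1 / (2 e). *)
Lemma weighted_fact_indep (omega : nat -> nat) e :
    (forall n, omega n <= 1) -> (forall n m, omega (n + c * m) = omega n) ->
  exists N0, forall N g h, N0 <= N ->
    e * \sum_(0 <= n < N) omega n * (F n == g) <=
    e * (\sum_(0 <= n < N) omega n * (F n == h)) + N.
Proof.
move=> om1 omc.
have [Y CY FY] := fin_all_exists2 phi_fact_mult_surj.
pose s := \max_h Y h; pose Q := p ^ (s + K).
have Ys h : Y h < p ^ s.
  by apply: leq_trans (ltn_expl s p_gt1); rewrite ltnS; exact: leq_bigmax.
have YQ h : Y h < Q by apply: leq_trans (Ys h) _; rewrite leq_exp2l // leq_addr.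
have omC n m : omega (n + C * m) = omega n by rewrite /C -mulnA mulnCA.
have Q0 : 0 < Q by rewrite expn_gt0; lia.
have [J HJ] : exists J, 2 * e * (Q - #|gT|) ^ J <= Q ^ J.
  apply: expn_dominates.
  have : 0 < #|gT| by apply/card_gt0P; exists 1%g.
  lia.
have blk := @block_sum_indep s omega (fun h => Ordinal (YQ h)) om1 omC CY Ys FY J 0 0.
set D := Q ^ J in HJ; set eps := (Q - #|gT|) ^ J in HJ.
have D0 : 0 < D by rewrite expn_gt0 Q0.
exists (2 * e * D) => N g h NN0.
pose G h n := omega n * (F n == h).
have full M : \sum_(0 <= n < M * D) G g n <= \sum_(0 <= n < M * D) G h n + M * eps.
  rewrite !big_nat_mul -[X in _ + X * _]subn0 -sum_nat_const_nat -big_split /=.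
  apply: leq_sum => i _; have [a Ha] := blk i (ltn0Sn 0).
  have shift k : \sum_(i * D <= j < i.+1 * D) G k j =
     \sum_(0 <= w < D) omega (p ^ 0 * (D * i + w) + 0) *
                       (F (p ^ 0 * (D * i + w) + 0) == k).
    rewrite mulSn -{1}[i * D]add0n big_addn addnK; apply: eq_bigr => w _.
    by rewrite /G expn0 mul1n addn0 addnC [D * i]mulnC.
  rewrite !shift; have /andP[_ ug] := Ha g; have /andP[lh _] := Ha h.
  by apply: leq_trans ug _; rewrite leq_add2r.
pose M := N %/ D; have MN : M * D <= N by exact: leq_trunc_div.
have G1 k n : G k n <= 1.
  by rewrite /G; apply: leq_trans (leq_mul (om1 n) (leq_b1 _)) _.
have rest : \sum_(M * D <= n < N) G g n <= D.
  apply: leq_trans (leq_sum _ (fun n _ => G1 g n)) _.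
  rewrite sum_nat_const_nat muln1.
  by have := ltn_pmod N D0; rewrite {1}(divn_eq N D) -/M; lia.
rewrite -/(G g _) [X in e * X](@big_cat_nat _ _ _ (M * D)) //=.
rewrite [X in _ <= e * X + _](@big_cat_nat _ _ _ (M * D)) //=.
have := full M; rewrite /G in rest *.
set A := \sum_(0 <= n < M * D) _; set A' := \sum_(0 <= n < M * D) _.
set B := \sum_(M * D <= n < N) _ in rest *; set B' := \sum_(M * D <= n < N) _.
have : 2 * e * (M * eps) <= N.
  by apply: leq_trans MN; rewrite mulnCA leq_mul2l HJ orbT.
nia.
Qed.

(** Once the counts for all h agree asymptotically, each of them is N / #|gT|,
    because they add up to N.  The progression c n + d is encoded by the weight
    that selects the residue class of d modulo c. *)
Theorem fact_equidistributed d e (A : {set gT}) :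
  exists N0, forall N, N0 <= N ->
    e * (#|gT| * \sum_(0 <= n < N) (F (c * n + d) \in A)) <= e * (#|A| * N) + N
 /\ e * (#|A| * N) <= e * (#|gT| * \sum_(0 <= n < N) (F (c * n + d) \in A)) + N.
Proof.
pose r := d %% c; pose D := d %/ c.
pose omega n : nat := n %% c == r.
have om1 n : omega n <= 1 by exact: leq_b1.
have omc n m : omega (n + c * m) = omega n by rewrite /omega mulnC addnC modnMDl.
pose cnt N h := \sum_(0 <= n < N) (F (c * n + d) == h).
have cntE N h : \sum_(0 <= n < (N + D) * c) omega n * (F n == h) =
    \sum_(0 <= n < D) (F (n * c + r) == h) + cnt N h.
  rewrite sum_nat_residue ?ltn_pmod // (@big_cat_nat _ _ _ D) ?leq_addl //=.
  rewrite -{2}[D]add0n big_addn addnK; congr (_ + _); apply: eq_bigr => n _.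
  rewrite (_ : (n + D) * c + r = c * n + d) //.
  by rewrite /D /r {3}(divn_eq d c); lia.
(* The factor t^2 absorbs the two summations, over A and over the group. *)
pose t := #|gT|; pose e' := e * (t * t).
have [N1 HN1] := weighted_fact_indep (2 * c * e') om1 omc.
have cnt_le N g h : N1 + 2 * e' * D + D <= N ->
    e' * cnt N g <= e' * cnt N h + N.
  move=> HN; have := HN1 ((N + D) * c) g h; rewrite !cntE.
  have lD k : \sum_(0 <= n < D) (F (n * c + r) == k) <= D.
    apply: (@leq_trans (\sum_(0 <= n < D) 1)); first by apply: leq_sum => n _;
      exact: leq_b1.
    by rewrite sum_nat_const_nat muln1 subn0.
  have N1l : N1 <= (N + D) * c.
    by apply: leq_trans (leq_pmulr _ c_gt0); lia.
  move: (lD g) (lD h); set u := bigop.body _ _ _; set v := bigop.body _ _ _.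
  move=> ug vh /(_ N1l) H.
  have c2 : 0 < 2 * c by rewrite muln_gt0.
  rewrite -(leq_pmul2l c2).
  have H1 : c * (2 * e' * v) <= c * (2 * e' * D) by rewrite !leq_mul2l vh !orbT.
  have H2 : c * (N1 + (2 * e' * D + D)) <= c * N by rewrite leq_mul2l;
    apply/orP; right; lia.
  nia.
exists (N1 + 2 * e' * D + D) => N HN.
set cntA := \sum_(0 <= n < N) _.
have cntAE (B : {set gT}) :
    \sum_(0 <= n < N) (F (c * n + d) \in B) = \sum_(g in B) cnt N g.
  rewrite exchange_big /=; apply: eq_bigr => n _.
  have [FB | FnB] := boolP (_ \in B); last first.
    by rewrite big1 // => g gB; case: eqP FnB => // ->; rewrite gB.
  rewrite (bigD1 _ FB) /= eqxx big1 ?addn0 // => g /andP[_ gF].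
  by rewrite eq_sym (negbTE gF).
have cntT : \sum_g cnt N g = N.
  transitivity (\sum_(g in [set: gT]) cnt N g); first by apply: eq_bigl => g;
    rewrite inE.
  rewrite -cntAE; under eq_bigr do rewrite inE /=.
  by rewrite sum_nat_const_nat muln1 subn0.
have t0 : 0 < t by apply/card_gt0P; exists 1%g.
have At : #|A| <= t by exact: max_card.
have cle g h := @cnt_le N g h HN.
rewrite /cntA cntAE; set S := \sum_(g in A) _.
have tsum n : t * n = \sum_(h : gT) n by rewrite sum_nat_const.
have Nsum : e' * N = \sum_h e' * cnt N h by rewrite -big_distrr /= cntT.
have up : t * (e' * S) <= #|A| * (e' * N + t * N).
  rewrite -[#|A| * _]sum_nat_const /S !big_distrr /=; apply: leq_sum => g _.
  rewrite Nsum !tsum -big_split /=; exact: leq_sum.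
have dn : #|A| * (e' * N) <= t * (e' * S) + #|A| * (t * N).
  rewrite -![#|A| * _]sum_nat_const /S !big_distrr -big_split /=.
  apply: leq_sum => h _; rewrite Nsum !tsum -big_split /=.
  exact: leq_sum.
have tt : 0 < t * t by rewrite muln_gt0 t0.
have aN : #|A| * (t * N) <= t * t * N by rewrite -mulnA leq_mul2r At orbT.
by split; rewrite -(leq_pmul2l tt) /e' in up dn *; nia.
Qed.

End FactorialImages.

(** * Negligible sets and digit sums *)

Lemma logn_fact_div p n M : prime p -> n <= M ->
  logn p n`! = \sum_(0 <= k < M) n %/ p ^ k.+1.
Proof.
move=> pp nM; rewrite logn_fact // big_add1 /= [RHS](@big_cat_nat _ _ _ n) //=.
rewrite [X in _ = _ + X]big_nat_cond [X in _ = _ + X]big1 ?addn0 // => k.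
rewrite andbT => /andP[nk _]; apply: divn_small.
by apply: leq_ltn_trans (ltn_expl k.+1 (prime_gt1 pp)); exact: leqW.
Qed.

Lemma logn_fact_digit p x y : prime p -> y < p ->
  logn p (p * x + y)`! = x + logn p x`!.
Proof.
move=> pp yp; have p0 := prime_gt0 pp.
rewrite (@logn_fact_div _ _ (p * x + y).+1) // big_nat_recl //.
rewrite expn1 divnDl ?dvdn_mulr // mulKn // divn_small // addn0; congr (_ + _).
rewrite (@logn_fact_div _ _ (p * x + y)) //; last by nia.
apply: eq_bigr => k _.
by rewrite expnS divnMA divnDl ?dvdn_mulr // mulKn // [y %/ p]divn_small // addn0.
Qed.

(** By Legendre's formula this is the sum of the base p digits of n when p is
    prime; the digits themselves are only met through [dsum_digit]. *)
Definition dsum p n := n - p.-1 * logn p n`!.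

Lemma dsumE p n : prime p -> p.-1 * logn p n`! + dsum p n = n.
Proof.
move=> pp; apply: subnKC; have p1 := prime_gt1 pp.
have [m] := ubnP n; elim: m n => // m IHm n; rewrite ltnS => nm.
have [-> | n0] := posnP n; first by rewrite fact0 logn1 muln0.
have xn : n %/ p < n by rewrite ltn_Pdiv.
have IH := IHm (n %/ p) (leq_trans xn nm).
rewrite [X in X <= _](_ : _ = p.-1 * logn p (p * (n %/ p) + n %% p)`!); last first.
  by rewrite [p * _]mulnC -divn_eq.
rewrite logn_fact_digit ?ltn_pmod ?prime_gt0 //.
have := leq_trunc_div n p; nia.
Qed.

Lemma dsum_digit p x y : prime p -> y < p ->
  dsum p (p * x + y) = dsum p x + y.
Proof.
move=> pp yp; have := dsumE (p * x + y) pp; have := dsumE x pp.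
rewrite logn_fact_digit //; have := prime_gt1 pp.
nia.
Qed.

(** The J lowest digits are bounded by p - 1, and the digit sum of the rest by
    the rest. *)
Lemma dsum_le p J n : prime p -> dsum p n <= p.-1 * J + n %/ p ^ J.
Proof.
move=> pp; have p0 := prime_gt0 pp; elim: J n => [|J IHJ] n.
  by rewrite muln0 expn0 divn1 leq_subr.
rewrite {1}(divn_eq n p) mulnC dsum_digit ?ltn_pmod // expnS divnMA mulnS.
have := IHJ (n %/ p); have := ltn_pmod n p0; lia.
Qed.

Section Variance.
Local Open Scope ring_scope.

Lemma sum_centered_digits p n :
  \sum_(y < n) ((2 * y)%:Z - p.-1%:Z) = (n * n.-1)%:Z - (n * p.-1)%:Z.
Proof.
elim: n => [|n IHn]; first by rewrite big_ord0.
by rewrite big_ord_recr /= IHn; case: n {IHn} => [|n] /=; lia.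
Qed.

(** Under the uniform distribution on [0, p^L) the L digits are independent
    with mean (p-1)/2, so the cross terms vanish by [sum_centered_digits].
    Everything is doubled to stay within the integers. *)
Lemma dsum_variance p L : prime p ->
  \sum_(0 <= n < (p ^ L)%N) ((2 * dsum p n)%:Z - (p.-1 * L)%:Z) ^+ 2
    <= (L * p ^ L * p ^ 2)%:Z.
Proof.
move=> pp; have p0 := prime_gt0 pp; elim: L => [|L IHL].
  by rewrite expn0 big_nat1 !muln0 mul0n.
rewrite expnSr big_nat_mul_ord exchange_big /=.
apply: (@le_trans _ _ (\sum_(0 <= i < (p ^ L)%N)
   (p%:Z * ((2 * dsum p i)%:Z - (p.-1 * L)%:Z) ^+ 2 + (p ^ 3)%:Z))); last first.
  rewrite big_split /= -mulr_sumr sumr_const_nat subn0 pmulrn -mulrzr intz.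
  apply: le_trans (lerD (ler_wpM2l _ IHL) (lexx _)) _ => //.
  by rewrite -!PoszM -PoszD lez_nat !expnS; lia.
apply: ler_sum => i _; set D := _ - (p.-1 * L)%:Z.
pose c (y : 'I_p) := (2 * y)%:Z - p.-1%:Z.
rewrite (eq_bigr (fun y => D ^+ 2 + (2 * D * c y + c y ^+ 2))); last first.
  move=> y _; rewrite [(i * p)%N]mulnC dsum_digit // /D /c mulnS mulnDr !PoszD; ring.
have c0 : \sum_(y < p) 2 * D * c y = 0.
  by rewrite -mulr_sumr sum_centered_digits subrr mulr0.
rewrite !big_split /= c0 add0r.
rewrite sumr_const card_ord pmulrn -mulrzr intz mulrC lerD2l.
apply: (@le_trans _ _ (\sum_(y < p) (p ^ 2)%:Z)).
  apply: ler_sum => y _; have := ltn_ord y; rewrite /c => yp.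
  by have [u up] : exists u, u = p.-1 by [exists p.-1]; nia.
by rewrite sumr_const card_ord pmulrn -mulrzr intz -PoszM lez_nat !expnS; lia.
Qed.
End Variance.

Lemma dsum_chebyshev p L tau : prime p ->
  tau ^ 2 * \sum_(0 <= n < p ^ L) ((2 * dsum p n + tau <= p.-1 * L)
                               || (p.-1 * L + tau <= 2 * dsum p n))
    <= L * p ^ L * p ^ 2.
Proof.
move=> pp; rewrite -lez_nat; apply: le_trans (dsum_variance L pp).
rewrite PoszM (big_morph Posz PoszD (erefl _)) mulr_sumr.
apply: ler_sum => n _; case far: (_ || _); last by rewrite mulr0 sqr_ge0.
rewrite mulr1; case/orP: far => far; nia.
Qed.

(** In other words (1 + 1/p)^j < j + 1, by induction on j. *)
Lemma expn_succ_lt p j : 1 < p -> 0 < j <= p -> p.+1 ^ j < j.+1 * p ^ j.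
Proof.
move=> p1; elim: j => // j IHj; case: j IHj => [_ _ | j IHj /andP[_ jp]].
  by rewrite !expn1; lia.
have {}IHj := IHj (ltnW jp); rewrite [X in X < _]expnS [X in _ < _ * X]expnS.
apply: (@leq_trans (p.+1 * (j.+2 * p ^ j.+1))); first by rewrite ltn_pmul2l.
by rewrite !mulnA leq_mul2r; apply/orP; right; nia.
Qed.

(** This says that log p / (p - 1) decreases. *)
Lemma expn_pred_swap q p : 1 < q -> q < p -> p ^ q.-1 < q ^ p.-1.
Proof.
case: q => // q q1; elim: p => // p IHp; rewrite ltnS leq_eqVlt => /orP[/eqP<- | qp].
  by rewrite /= expnS; apply: expn_succ_lt => //; lia.
have {}IHp := IHp qp; case: p => // p in qp IHp *; rewrite /= in IHp *.
rewrite -(ltn_pmul2l (m := p.+1 ^ q)) ?expn_gt0 // expnSr mulnA.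
have := @expn_succ_lt p.+1 q; have q0 : 0 < q by lia.
rewrite q0 /= => /(_ _ _) H.
apply: (@ltn_trans (p.+1 ^ q * (q.+1 * p.+1 ^ q))).
  by rewrite ltn_pmul2l ?expn_gt0 // H //; lia.
by rewrite -mulnA ltn_pmul2l ?expn_gt0 // mulnC ltn_pmul2r.
Qed.

(** Density zero, the integer e standing for the inverse of an epsilon. *)
Definition negligible (B : pred nat) :=
  forall e, exists N0, forall N, N0 <= N -> e * \sum_(0 <= n < N) B n <= N.

Lemma leq_sum_widen (f : nat -> nat) m n : m <= n ->
  \sum_(0 <= i < m) f i <= \sum_(0 <= i < n) f i.
Proof. by move=> mn; rewrite [X in _ <= X](@big_cat_nat _ _ _ m) //= leq_addr. Qed.

(** Let L and l + 1 be the numbers of base p and base q digits of N.  The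
    typical digit sums below N are (p-1)L/2 and (q-1)(l+1)/2.  Since q^l <= N <
    p^L and p^(q-1) < q^(p-1), the former exceeds the latter by l/(2A) up to a
    bounded term, where A witnesses the strictness of the last inequality.  A
    number whose digit sums fail to show this gap has one of them at distance
    tau/2 from its mean, with tau of the order of l, and Chebyshev's inequality
    leaves a proportion of order 1/l of such numbers. *)
Lemma dsum_gap_negligible q p M : prime q -> prime p -> q < p ->
  negligible (fun n => dsum p n < dsum q n + M).
Proof.
move=> qq pp qp e; have q1 := prime_gt1 qq; have p1 := prime_gt1 pp.
have [A HA] := expn_dominates p (expn_pred_swap q1 qp).
have A0 : 0 < A by case: A HA => //; rewrite !expn0; lia.
set W := 8 * A * e * (p ^ 3 + q ^ 3); set tau0 := M + q + W.
exists (q ^ (4 * A * tau0)) => N HN.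
have N0 : 0 < N by apply: leq_trans HN; rewrite expn_gt0; lia.
set l := trunc_log q N; set L := (trunc_log p N).+1.
have lN : q ^ l <= N by exact: trunc_logP.
have Nl : N < q ^ l.+1 by exact: trunc_log_ltn.
have LN : p ^ L.-1 <= N by exact: trunc_logP.
have NL : N < p ^ L by exact: trunc_log_ltn.
have ltau0 : 4 * A * tau0 <= l by exact: trunc_log_max.
have A4 : 0 < 4 * A by lia.
pose tau := l %/ (4 * A).
have tau_ge : tau0 <= tau by rewrite leq_divRL // mulnC.
have l_ge : 4 * A * tau <= l by rewrite mulnC leq_trunc_div.
have l_lt : l < 4 * A * tau.+1 by rewrite mulnC -ltn_divLR.
(* Compare the exponents of p in q^l <= N < p^L raised to the power (p-1)A. *)
have key : (q.-1 * A + 1) * l < L * (p.-1 * A).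
  rewrite -(ltn_exp2l _ _ p1) [X in _ < X]expnM.
  apply: (@leq_ltn_trans (N ^ (p.-1 * A))); last first.
    by rewrite ltn_exp2r // muln_gt0 A0; lia.
  apply: (@leq_trans ((q ^ l) ^ (p.-1 * A))); last first.
    by rewrite leq_exp2r // muln_gt0 A0; lia.
  rewrite -expnM [l * _]mulnC !(expnM _ _ l) addn1 expnS !expnM.
  by case: (l) => // l'; rewrite leq_exp2r.
have LLe : L <= l.+1.
  rewrite -(ltn_exp2l _ _ p1) -/L; apply: leq_ltn_trans LN _.
  by apply: leq_trans Nl _; rewrite leq_exp2r // ltnW.
have gap : q.-1 * l + 4 * tau < L * p.-1.
  by rewrite -(ltn_pmul2l A0); nia.
pose far_p n := (2 * dsum p n + tau <= p.-1 * L) || (p.-1 * L + tau <= 2 * dsum p n).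
pose far_q n :=
  (2 * dsum q n + tau <= q.-1 * l.+1) || (q.-1 * l.+1 + tau <= 2 * dsum q n).
have tau_MqW : M + q + W <= tau by [].
have bad_far n : (dsum p n < dsum q n + M) <= far_p n + far_q n.
  case: ltnP => // bad; suff: far_p n || far_q n by case: far_p => //= ->.
  rewrite /far_p /far_q; apply/negPn; rewrite !negb_or -!ltnNge.
  apply/negP => /andP[/andP[sp _] /andP[_ sq]].
  by have := mulnS q.-1 l; rewrite [L * _]mulnC in gap; lia.
have cp : tau ^ 2 * \sum_(0 <= n < p ^ L) far_p n <= l.+1 * N * p ^ 3.
  apply: leq_trans (dsum_chebyshev _ _ pp) _.
  rewrite (_ : L * p ^ L * p ^ 2 = L * p ^ L.-1 * p ^ 3).
    by rewrite leq_mul2r leq_mul ?orbT.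
  have pL : p ^ L = p * p ^ L.-1 by rewrite -expnS.
  rewrite pL [p ^ 3]expnS; move: (p ^ L.-1) (p ^ 2) => u v; lia.
have cq : tau ^ 2 * \sum_(0 <= n < q ^ l.+1) far_q n <= l.+1 * N * q ^ 3.
  apply: leq_trans (dsum_chebyshev _ _ qq) _.
  rewrite (_ : l.+1 * q ^ l.+1 * q ^ 2 = l.+1 * q ^ l * q ^ 3).
    by rewrite leq_mul2r leq_mul ?orbT.
  by rewrite [q ^ l.+1]expnS [q ^ 3]expnS; move: (q ^ l) (q ^ 2) => u v; lia.
set cnt := \sum_(0 <= n < N) _.
have cnt_le : tau ^ 2 * cnt <= l.+1 * N * (p ^ 3 + q ^ 3).
  rewrite mulnDr; apply: leq_trans (leq_add cp cq); rewrite -mulnDr leq_mul2l.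
  apply/orP; right; apply: (@leq_trans (\sum_(0 <= n < N) (far_p n + far_q n))).
    by apply: leq_sum => n _; exact: bad_far.
  by rewrite big_split /= leq_add // leq_sum_widen // ltnW.
have tau0_gt0 : 0 < tau by apply: leq_trans tau_ge; rewrite /tau0; lia.
have lA : l.+1 <= 8 * A * tau.
  have At : A <= A * tau by rewrite leq_pmulr.
  by move: l_lt At; clear; lia.
have tau2 : 0 < tau ^ 2 by rewrite expn_gt0 tau0_gt0.
rewrite -(leq_pmul2l tau2) mulnCA; apply: leq_trans (leq_mul (leqnn e) cnt_le) _.
apply: (@leq_trans (e * (8 * A * tau * N * (p ^ 3 + q ^ 3)))).
  by rewrite leq_mul2l !leq_mul2r lA !orbT.
have Wt : W * (tau * N) <= tau * (tau * N) by rewrite leq_mul2r; apply/orP;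
  right; lia.
by rewrite /W in Wt; rewrite -[tau ^ 2]mulnn; move: Wt; clear;
  move: (p ^ 3 + q ^ 3); lia.
Qed.

Lemma negligible_bounded (B : pred nat) W :
  (forall n, B n -> n < W) -> negligible B.
Proof.
move=> BW e; exists (e * W) => N; apply: leq_trans; rewrite leq_mul2l.
apply/orP; right; have [NW | WN] := leqP N W.
  apply: leq_trans NW; apply: leq_trans (leq_sum _ (fun n _ => leq_b1 (B n))) _.
  by rewrite sum_nat_const_nat muln1 subn0.
rewrite (@big_cat_nat _ _ _ W) //=; last exact: ltnW.
rewrite [X in _ + X]big_nat_cond [X in _ + X]big1 => [|n]; last first.
  by rewrite andbT => /andP[Wn _]; case Bn : (B n) => //; have := BW n Bn; lia.
rewrite addn0; apply: leq_trans (leq_sum _ (fun n _ => leq_b1 (B n))) _.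
by rewrite sum_nat_const_nat muln1 subn0.
Qed.

(** Such n are bounded, as digit sums grow more slowly than any linear
    function. *)
Lemma dsum_large_negligible q A M : prime q ->
  negligible (fun n => n < A * dsum q n + M).
Proof.
move=> qq; have q1 := prime_gt1 qq.
(* With 2A digits removed, [dsum_le] leaves at most n / (2A). *)
apply: (@negligible_bounded _ (2 * (A * (q.-1 * (2 * A)) + M))) => n lt.
have H := dsum_le (2 * A) n qq.
have H2 : A * dsum q n <= A * (q.-1 * (2 * A) + n %/ q ^ (2 * A)).
  by rewrite leq_mul2l H orbT.
have H3 : 2 * A * (n %/ q ^ (2 * A)) <= n.
  apply: leq_trans (leq_trunc_div n (q ^ (2 * A))); rewrite mulnC leq_mul2l.
  by rewrite ltnW ?orbT // ltn_expl.
nia.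
Qed.

Lemma negligible_exists (I : finType) (P : pred I) (B : I -> pred nat) :
  (forall i, P i -> negligible (B i)) ->
  negligible (fun n => [exists (i | P i), B i n]).
Proof.
move=> negB e.
have [N0 HN0] : exists N0 : I -> nat, forall i N, N0 i <= N -> P i ->
    e * #|I| * \sum_(0 <= n < N) B i n <= N.
  suff ex i : exists N0, forall N, N0 <= N -> P i ->
      e * #|I| * \sum_(0 <= n < N) B i n <= N by exact: fin_all_exists ex.
  have [Pi | _] := boolP (P i); last by exists 0.
  by have [N0 HN0] := negB i Pi (e * #|I|); exists N0 => N NN _; exact: HN0.
have [I0 | I0] := posnP #|I|.
  exists 0 => N _; rewrite big1 ?muln0 // => n _.
  by case: existsP => // -[i]; have := max_card (pred1 i); rewrite I0 card1.
exists (\max_i N0 i) => N HN; rewrite -(leq_pmul2l I0) mulnCA mulnA.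
apply: (@leq_trans (\sum_(i | P i) e * #|I| * \sum_(0 <= n < N) B i n)).
  rewrite -big_distrr /= leq_mul2l exchange_big /=; apply/orP; right.
  apply: leq_sum => n _; case: existsP => //= -[i /andP[Pi Bi]].
  by rewrite (bigD1 i) //= Bi.
apply: (@leq_trans (\sum_(i | P i) N)).
  apply: leq_sum => i Pi; apply: HN0 => //; apply: leq_trans HN; exact: leq_bigmax.
by rewrite sum_nat_const leq_mul2r max_card orbT.
Qed.

Lemma negligible_progression (B : pred nat) c d : 0 < c ->
  negligible B -> negligible (fun n => B (c * n + d)).
Proof.
move=> c0 negB e; have [N0 HN0] := negB (2 * c * e).
exists (N0 + d) => N HN.
have H := HN0 (c * N + d); have Nc : N <= c * N by rewrite leq_pmull.
have {}H : 2 * c * e * \sum_(0 <= n < c * N + d) B n <= c * N + d by apply: H; lia.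
have Hd : d <= c * N by lia.
suff HB : \sum_(0 <= n < N) B (c * n + d) <= \sum_(0 <= n < c * N + d) B n.
  rewrite -(leq_pmul2l (m := 2 * c)) ?muln_gt0 //.
  have : 2 * c * e * \sum_(0 <= n < N) B (c * n + d) <= 2 * c * e * \sum_(0 <= n < c * N + d) B n.
    by rewrite leq_mul2l HB orbT.
  by nia.
elim: N {HN H Nc Hd} => [|N IHN]; first by rewrite big_geq.
have le : (c * N + d).+1 <= c * N.+1 + d by rewrite mulnS; lia.
apply: leq_trans (leq_sum_widen _ le).
by rewrite !big_nat_recr //= leq_add2r.
Qed.

Lemma negligible_sub (B B' : pred nat) :
  (forall n, B n -> B' n) -> negligible B' -> negligible B.
Proof.
move=> BB' negB' e; have [N0 HN0] := negB' e; exists N0 => N NN.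
apply: leq_trans (HN0 N NN); rewrite leq_mul2l; apply/orP; right.
by apply: leq_sum => n _; case Bn : (B n) => //; rewrite BB'.
Qed.

(** Multiplied by (p-1)(q-1), the inequality compares l1 (p-1) (n - s_q(n)) and
    l2 (q-1) (n - s_p(n)) up to a constant.  If the coefficients of n differ, the
    digit sums are too small to matter; if they agree, the digit sums decide. *)
Lemma legendre_race_negligible p q l1 l2 M : prime p -> prime q -> 0 < l1 ->
    l2 * q.-1 < l1 * p.-1 \/ l2 * q.-1 = l1 * p.-1 /\ q < p ->
  negligible (fun n => l1 * logn q n`! < l2 * (logn p n`! + M)).
Proof.
move=> pp qq l1_gt0 race; have p1 := prime_gt1 pp; have q1 := prime_gt1 qq.
have bad_dsum n : l1 * logn q n`! < l2 * (logn p n`! + M) ->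
    l1 * p.-1 * (n - dsum q n) < l2 * q.-1 * (n - dsum p n + p.-1 * M).
  have pq0 : 0 < p.-1 * q.-1 by rewrite muln_gt0; lia.
  have -> : n - dsum q n = q.-1 * logn q n`! by rewrite -{1}(dsumE n qq) addnK.
  have -> : n - dsum p n = p.-1 * logn p n`! by rewrite -{1}(dsumE n pp) addnK.
  rewrite -(ltn_pmul2l pq0).
  by move: p.-1 q.-1 (logn p _) (logn q _) => *; lia.
have dle r n : prime r -> dsum r n <= n by move=> rr;
  rewrite -{2}(dsumE n rr) leq_addl.
case: race => [lt | [eq qp]].
  apply: negligible_sub (dsum_large_negligible (l1 * p.-1) (l2 * q.-1 * (p.-1 * M)) qq).
  move=> n /bad_dsum H; have := dle q n qq; have := dle p n pp.
  move: H lt; move: (l1 * p.-1) (l2 * q.-1) (p.-1 * M) => A1 A2 M'; clear; nia.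
apply: negligible_sub (dsum_gap_negligible (p.-1 * M) qq pp qp).
move=> n /bad_dsum; rewrite eq ltn_pmul2l; last by rewrite muln_gt0; lia.
have := dle q n qq; have := dle p n pp; lia.
Qed.

Lemma prod_coprime_dvdn (I : finType) (P : pred I) (F : I -> nat) X :
  (forall i j, i != j -> coprime (F i) (F j)) ->
  (forall i, P i -> F i %| X) -> \prod_(i | P i) F i %| X.
Proof.
move=> coF FX; have : uniq (index_enum I) by exact: index_enum_uniq.
elim: (index_enum I) => [|i s IHs] /=; first by rewrite big_nil dvd1n.
case/andP=> iNs s_uniq; rewrite big_cons; case: ifP => Pi; last exact: IHs.
rewrite Gauss_dvd ?FX ?IHs //; rewrite big_seq_cond.
apply: (big_ind (fun x => coprime (F i) x)) => [|x y cx cy|j /andP[js _]].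
- exact: coprimen1.
- by rewrite coprimeMr cx.
by apply: coF; apply: contraNneq iNs => ->.
Qed.

(** * The class of an integer in a finite quotient of the p-adic group *)

Section LocalClass.
Variables (p K N : nat).
Hypotheses (p_prime : prime p) (K_gt0 : 0 < K) (N_gt1 : 1 < N).
Local Notation q := (p ^ K).

(** The image of n in the quotient of the multiplicative group of Q_p by the
    subgroup generated by 1 + p^K Z_p and p^N: the unit part modulo p^K and the
    valuation modulo N.  The default value 1 is never taken at positive n. *)
Definition local_class (n : nat) : {unit 'Z_q} * 'Z_N :=
  (insubd (1%g : {unit 'Z_q}) ((n`_p^')%:R%R : 'Z_q), (logn p n)%:R%R).

Let q_gt1 : 1 < q.
Proof. by rewrite -(exp1n K) ltn_exp2r ?prime_gt1. Qed.


Lemma val_local_class1 n : 0 < n -> val (local_class n).1 = (n`_p^')%:R%R.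
Proof.
move=> n0; rewrite /local_class /= val_insubd.
by case: ifP => // /negP[]; rewrite unitZpE // coprimeXl // coprime_part.
Qed.

Lemma local_class1_mod n : 0 < n ->
  val (local_class n).1 = n`_p^' %[mod q].
Proof. by move=> n0; rewrite val_local_class1 // val_Zp_nat // modn_mod. Qed.

Lemma local_class2_val n : (local_class n).2 = logn p n %% N :> nat.
Proof. by rewrite /= val_Zp_nat. Qed.

Lemma local_classM x y : 0 < x -> 0 < y ->
  local_class (x * y) = (local_class x * local_class y)%g.
Proof.
move=> x0 y0; apply/eqP; rewrite xpair_eqE; apply/andP; split; last first.
  by rewrite /= lognM // natrD.
rewrite -val_eqE /= -!/(local_class _).1; apply/eqP.
have := val_local_class1; rewrite /= => vE.
by rewrite !vE ?muln_gt0 ?x0 // partnM // natrM.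
Qed.

(** The congruence determines the valuation, which is below t, and leaves at
    least K digits of the unit part. *)
Lemma local_class_mod t x y : 0 < x -> 0 < y -> ~~ (p ^ t %| x) ->
  x = y %[mod p ^ (t + K)] -> local_class x = local_class y.
Proof.
move=> x0 y0 px xy; have p1 := prime_gt1 p_prime.
have dvdE j : j <= t + K -> (p ^ j %| x) = (p ^ j %| y).
  move=> jt; have dj : p ^ j %| p ^ (t + K) by rewrite dvdn_exp2l.
  by rewrite /dvdn -(modn_dvdm x dj) xy modn_dvdm.
have lx : logn p x < t by rewrite ltnNge -pfactor_dvdn.
have ly : logn p y < t by rewrite ltnNge -pfactor_dvdn // -dvdE ?leq_addr.
have lE : logn p x = logn p y.
  apply/eqP; rewrite eqn_leq -!pfactor_dvdn // -dvdE; last by lia.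
  by rewrite pfactor_dvdnn [X in _ && X]dvdE ?pfactor_dvdnn //; lia.
apply/eqP; rewrite xpair_eqE lE eqxx andbT -val_eqE; apply/eqP.
have := val_local_class1; rewrite /= => vE; rewrite !vE //.
rewrite -Zp_nat_mod // -[RHS]Zp_nat_mod //; congr (_%:R)%R.
have dq : q %| p ^ (t + K - logn p x) by rewrite dvdn_exp2l //; lia.
rewrite -(modn_dvdm _ dq) -[RHS](modn_dvdm _ dq); congr (_ %% _).
apply/eqP; rewrite -(eqn_pmul2l (m := p ^ logn p x)) ?expn_gt0 ?prime_gt0 //.
rewrite !muln_modr -expnD subnKC; last by lia.
by rewrite {2}lE !pow_part_mul // xy.
Qed.

Lemma local_class_surj h : exists2 v, 0 < v & local_class v = h.
Proof.
case: h => u e; pose v := nat_of_ord (val u); have p0 := prime_gt0 p_prime.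
have cqv : coprime q v.
  by rewrite -unitZpE // /v natr_Zp; exact: valP u.
have pv : coprime p v by rewrite -(coprime_pexpl _ _ K_gt0).
have v0 : 0 < v by case: (v) cqv => //; rewrite /coprime gcdn0; lia.
exists (p ^ e * v); first by rewrite muln_gt0 expn_gt0 p0.
have lv : logn p v = 0 by rewrite logn_coprime.
apply/eqP; rewrite xpair_eqE; apply/andP; split.
  rewrite -val_eqE; apply/eqP.
  have := val_local_class1; rewrite /= => vE.
  rewrite !vE ?muln_gt0 ?expn_gt0 ?p0 //.
  rewrite partnM ?expn_gt0 ?p0 // part_p'nat ?mul1n; last first.
    by rewrite pnatX pnatNK pnat_id ?orbT.
  by rewrite part_pnat_id ?natr_Zp // p'natE // -prime_coprime.
by rewrite lognM ?expn_gt0 ?p0 // pfactorK // lv addn0 natr_Zp.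
Qed.

Lemma local_class_commute g h : (g * h = h * g :> {unit 'Z_q} * 'Z_N)%g.
Proof.
case: g h => [u e] [v f]; apply/eqP; rewrite xpair_eqE /=; apply/andP; split.
  by rewrite -val_eqE /= mulrC.
by apply/eqP; exact: addrC.
Qed.

Lemma card_local_classes : #|{: {unit 'Z_q} * 'Z_N}| = totient q * N.
Proof.
rewrite card_prod [#|'Z_N|]card_ord (Zp_cast N_gt1) -card_units_Zp; last exact: ltnW.
by rewrite cardsT.
Qed.

Lemma card_units_such (P : pred nat) :
  #|[set u : {unit 'Z_q} | P (val u)]| =
  \sum_(0 <= x < q) (coprime q x && P x).
Proof.
rewrite -(card_imset _ val_inj) -sum1_card.
rewrite -[X in \sum_(0 <= _ < X) _](Zp_cast q_gt1) big_mkord.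
rewrite big_mkcond /=; apply: eq_bigr => x _.
rewrite -unitZpE // natr_Zp.
case: imsetP => [[u]|nu].
  by rewrite inE => Pu ->; rewrite Pu andbT (valP u).
case: (boolP (x \is a GRing.unit)) => //= Ux; case Px : (P x) => //.
by case: nu; exists (Sub x Ux); rewrite ?inE SubK.
Qed.
End LocalClass.

(** * Last nonzero digits as a function of the class *)

Section LastDigits.
Variables (p l m k : nat).
Hypotheses (p_prime : prime p) (l_gt0 : 0 < l) (pm : coprime p m)
           (m_gt0 : 0 < m) (k_gt0 : 0 < k).
Let b := p ^ l * m.
Local Notation q := (p ^ (k * l)).

Let p_gt0 : 0 < p. Proof. exact: prime_gt0. Qed.

Let kl_gt0 : 0 < k * l. Proof. by rewrite muln_gt0 k_gt0. Qed.

Let b_gt1 : 1 < b.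
Proof.
by rewrite /b (leq_trans _ (leq_pmulr _ m_gt0)) // -(exp1n l) ltn_exp2r ?prime_gt1.
Qed.

(** Divisibility by m^(f+k) means that the primes of m do not limit the power
    of b in X, so nu b X = f, and that the quotient vanishes modulo m^k; the
    Chinese remainder theorem leaves the condition modulo p^(k l).  Multiplying
    it by m^f, invertible modulo p, undoes the division of X by m^f. *)
Lemma ell_eqE a X : 0 < X -> a < b ^ k -> let f := logn p X %/ l in
  m ^ (f + k) %| X ->
  (ell b k X == a) = (m ^ k %| a) &&
    (p ^ (logn p X %% l) * X`_p^' == m ^ f * a %[mod q]).
Proof.
move=> X0 ab f mX; set g := logn p X %% l.
have eE : logn p X = l * f + g by rewrite mulnC /f /g -divn_eq.
have mfX : m ^ f %| X by apply: dvdn_trans mX; rewrite dvdn_exp2l ?leq_addr.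
have bE j : b ^ j = p ^ (l * j) * m ^ j by rewrite /b expnMn expnM.
have cpm i j : coprime (p ^ i) (m ^ j) by rewrite coprimeXl ?coprimeXr.
have nuE : nu b X = f.
  apply/eqP; rewrite eqn_leq -nuP // bE Gauss_dvd // mfX andbT.
  rewrite pfactor_dvdn // eE leq_addr andbT leqNgt -nuP // bE.
  rewrite Gauss_dvd // pfactor_dvdn // eE mulnS addnC leq_add2l.
  by rewrite leqNgt ltn_pmod.
rewrite /ell nuE; set W := X %/ b ^ f.
have WE : W * b ^ f = X.
  by apply: divnK; rewrite bE Gauss_dvd // mfX pfactor_dvdn // eE leq_addr.
have mW : m ^ k %| W.
  move: mX; rewrite -WE bE addnC expnD mulnA dvdn_pmul2r ?expn_gt0 ?m_gt0 //.
  by rewrite mulnC Gauss_dvdr // coprime_sym.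
have WmE : m ^ f * W = p ^ g * X`_p^'.
  have pl0 : 0 < p ^ (l * f) by rewrite expn_gt0 p_gt0.
  apply/eqP; rewrite -(eqn_pmul2l pl0) mulnA -bE mulnC WE mulnA -expnD -eE.
  by rewrite pow_part_mul.
rewrite -{1}(modn_small ab) bE mulnC chinese_remainder; last first.
  by rewrite coprime_sym.
have -> : (W == a %[mod m ^ k]) = (m ^ k %| a).
  by rewrite (eqP mW) eq_sym.
by rewrite -WmE eqn_modM_coprime [k * l]mulnC ?cpm.
Qed.

Lemma pow_unit_mod_inj i j x y : i < k * l -> j < k * l ->
  coprime p x -> coprime p y -> p ^ i * x = p ^ j * y %[mod q] -> i = j.
Proof.
wlog ij : i j x y / i <= j => [th|] ik jk px py E.
  have [ij | /ltnW ji] := leqP i j; first exact: (th i j x y).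
  by apply: esym; apply: (th j i y x) => //; exact: esym.
apply/eqP; rewrite eqn_leq ij leqNgt /=; apply/negP => lij.
have d1 : p ^ i.+1 %| p ^ (k * l) by rewrite dvdn_exp2l.
have : p ^ i.+1 %| p ^ i * x.
  rewrite /dvdn -(modn_dvdm _ d1) E modn_dvdm // -/(dvdn _ _).
  by rewrite dvdn_mulr // dvdn_exp2l.
rewrite expnSr dvdn_pmul2l ?expn_gt0 ?p_gt0 // => px'.
by move: px; rewrite prime_coprime // px'.
Qed.

(** Comparing valuations, which are below k l, forces e mod l = v_p(a).  Then x
    is prescribed modulo p^(k l - v_p(a)), and automatically prime to p because
    this exponent is positive. *)
Lemma count_unit_solutions a e w : 0 < a -> logn p a < l -> coprime p w ->
  \sum_(0 <= x < q) (coprime q x && (p ^ (e %% l) * x == w * a %[mod q]))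
  = (e %% l == logn p a) * p ^ logn p a.
Proof.
move=> a0 al pw; set g := logn p a.
have lkl : l <= k * l by rewrite leq_pmull.
have gk : g < k * l by exact: leq_trans lkl.
have ek : e %% l < k * l by apply: leq_trans lkl; rewrite ltn_pmod.
have waE : w * a = p ^ g * (w * a`_p^') by rewrite mulnCA pow_part_mul.
have pwa : coprime p (w * a`_p^') by rewrite coprimeMr pw coprime_part.
case: (eqVneq (e %% l) g) => [-> | eg]; last first.
  rewrite mul0n big1 // => x _; case: andP => // -[cx /eqP E].
  case/eqP: eg; rewrite waE in E; apply: (pow_unit_mod_inj ek gk _ pwa E).
  by move: cx; rewrite coprime_pexpl.
rewrite mul1n; set r := p ^ (k * l - g).
have qE : q = p ^ g * r by rewrite -expnD subnKC // ltnW.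
have r0 : 0 < r by rewrite expn_gt0 p_gt0.
have pr : p %| r by rewrite -{1}(expn1 p) dvdn_exp2l //; lia.
transitivity (\sum_(0 <= x < q) (x %% r == (w * a`_p^') %% r) * 1); last first.
  rewrite {1}qE sum_nat_residue ?ltn_pmod // sum_nat_const_nat subn0 muln1 //.
apply: eq_bigr => x _; rewrite muln1; congr nat_of_bool.
rewrite waE [in X in _ && X]qE -!muln_modr eqn_pmul2l ?expn_gt0 ?p_gt0 //.
apply: andb_idl => /eqP E; rewrite coprimeXl // prime_coprime //.
by rewrite /dvdn -(modn_dvdm _ pr) E modn_dvdm // -/(dvdn _ _) -prime_coprime.
Qed.

(** The modulus N' l for valuations is chosen so that the valuation of X modulo
    N' l determines both the valuation modulo l and the class of m^f modulo
    p^(k l), where f is the quotient of the valuation by l. *)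
Variables (N' : nat).
Hypotheses (N'_gt1 : 1 < N') (mN' : m ^ N' = 1 %[mod q]).

Let N_gt1 : 1 < N' * l.
Proof. by apply: leq_trans N'_gt1 _; rewrite leq_pmulr. Qed.

Definition ell_classes a : {set {unit 'Z_q} * 'Z_(N' * l)} :=
  [set h : {unit 'Z_q} * 'Z_(N' * l) |
     p ^ ((h.2 : nat) %% l) * (val h.1 : nat) ==
     m ^ ((h.2 : nat) %/ l) * a %[mod q]].

Lemma mem_ell_classes a X : 0 < X ->
  (local_class p (k * l) (N' * l) X \in ell_classes a) =
  (p ^ (logn p X %% l) * X`_p^' == m ^ (logn p X %/ l) * a %[mod q]).
Proof.
move=> X0; rewrite inE -modnMmr local_class1_mod // modnMmr.
rewrite !local_class2_val // modn_dvdm ?dvdn_mull //.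
have mE f : m ^ (f %% N') = m ^ f %[mod q].
  have m1 : (m ^ N') ^ (f %/ N') = 1 %[mod q] by rewrite -modnXm mN' modnXm exp1n.
  rewrite [in RHS](divn_eq f N') expnD [_ * N']mulnC [m ^ (N' * _)]expnM.
  by rewrite -[RHS]modnMml m1 modnMml mul1n.
by rewrite -modn_divl -(modnMml (m ^ _)) mE modnMml.
Qed.

Lemma card_ell_classes a : 0 < a -> logn p a < l ->
  #|ell_classes a| = N' * p ^ logn p a.
Proof.
move=> a0 al.
have -> : #|ell_classes a| = \sum_(e : 'Z_(N' * l)) #|[set u : {unit 'Z_q} |
    p ^ ((e : nat) %% l) * (val u : nat) == m ^ ((e : nat) %/ l) * a %[mod q]]|.
  transitivity (\sum_(h : {unit 'Z_q} * 'Z_(N' * l))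
      (if (h.1, h.2) \in ell_classes a then 1 else 0)).
    by rewrite -sum1_card big_mkcond /=; apply: eq_bigr => -[].
  rewrite -(pair_bigA _ (fun u e => if (u, e) \in ell_classes a then 1 else 0)).
  rewrite exchange_big /=.
  apply: eq_bigr => e _; rewrite -sum1_card [RHS]big_mkcond /=.
  by apply: eq_bigr => u _; rewrite !inE.
transitivity (\sum_(e : 'Z_(N' * l)) (e %% l == logn p a) * p ^ logn p a).
  apply: eq_bigr => e _;
    rewrite -(@count_unit_solutions a e (m ^ (e %/ l))) ?coprimeXr //.
  exact: (card_units_such p_prime _ (fun x =>
    p ^ (e %% l) * x == m ^ (e %/ l) * a %[mod q])).
rewrite -(big_mkord xpredT (fun e => (e %% l == logn p a) * p ^ logn p a)) Zp_cast //.
by rewrite sum_nat_residue // sum_nat_const_nat subn0.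
Qed.
End LastDigits.

(** * Densities *)

(** Density u/v: the two inequalities bound the error, multiplied by v, by
    N / e. *)
Definition nat_density (A : pred nat) (u v : nat) := forall e, exists N0,
  forall N, N0 <= N ->
    e * (v * \sum_(0 <= n < N) A n) <= e * (u * N) + N /\
    e * (u * N) <= e * (v * \sum_(0 <= n < N) A n) + N.

Lemma nat_density_perturb (A A' B : pred nat) u v :
  (forall n, ~~ B n -> A n = A' n) -> negligible B ->
  nat_density A' u v -> nat_density A u v.
Proof.
move=> AA' negB dA' e; have [N1 HN1] := dA' (2 * e).
have [N2 HN2] := negB (2 * (e * v)); exists (N1 + N2) => N NN.
have [up dn] := HN1 N (leq_trans (leq_addr _ _) NN).
have := HN2 N (leq_trans (leq_addl _ _) NN).
have AB : \sum_(0 <= n < N) A n <= \sum_(0 <= n < N) A' n + \sum_(0 <= n < N) B n.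
  rewrite -big_split /=; apply: leq_sum => n _.
  case Bn : (B n); last by rewrite addn0 AA' ?Bn.
  by rewrite addn1 (leq_trans (leq_b1 _)).
have AB' : \sum_(0 <= n < N) A' n <= \sum_(0 <= n < N) A n + \sum_(0 <= n < N) B n.
  rewrite -big_split /=; apply: leq_sum => n _.
  case Bn : (B n); last by rewrite addn0 AA' ?Bn.
  by rewrite addn1 (leq_trans (leq_b1 _)).
move: AB AB' up dn;
  move: (\sum_(0 <= n < N) A n) (\sum_(0 <= n < N) A' n) (\sum_(0 <= n < N) B n).
move=> a a' z /(leq_mul (leqnn (e * v))) AB /(leq_mul (leqnn (e * v))) AB';
  clear -AB AB'.
by move=> up dn zN; split; lia.
Qed.

Section Density.
Local Open Scope ring_scope.
Local Open Scope classical_set_scope.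

Lemma nat_density_has_density (R : realType) (A : pred nat) u v :
  (0 < v)%N -> nat_density A u v -> has_density A (u%:R / v%:R : R).
Proof.
move=> v0 dA; apply/cvgrPdist_le => eps eps0.
(* Half of eps absorbs the error 1/e, the other half the shift of [0, n) to
   [1, n], which changes the count by at most one. *)
have [e e0 e_eps] : exists2 e, (0 < e)%N & 2 / eps <= e%:R :> R.
  exists (Num.bound (2 / eps)).+1 => //; apply: ltW.
  apply: lt_trans (archi_boundP _) _; first by rewrite divr_ge0 // ltW.
  by rewrite ltr_nat.
have [N0 HN0] := dA e.
exists (N0 + e)%N => //= n /= Nn.
have n0 : (0 < n)%N by apply: leq_trans Nn; rewrite addn_gt0 e0 orbT.
have [] := HN0 n (leq_trans (leq_addr _ _) Nn).
set S := (\sum_(0 <= i < n) A i)%N; set T := count _ _.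
have TS : (S <= T.+1 /\ T <= S.+1)%N.
  have -> : T = (\sum_(0 <= i < n) A i.+1)%N.
    rewrite /T -sum1_count big_mkcond /=.
    have -> : iota 1 n = index_iota 1 n.+1 by rewrite /index_iota subn1.
    by rewrite big_add1 /=; apply: eq_bigr => i _; rewrite unfold_in; case: (A _).
  have : (\sum_(0 <= i < n.+1) A i = S + A n)%N by rewrite big_nat_recr.
  rewrite big_nat_recl //; have := leq_b1 (A n); have := leq_b1 (A 0%N); lia.
move=> up dn.
have en : (e <= n)%N by exact: leq_trans (leq_addl _ _) Nn.
have [upT dnT] : (e * (v * T) <= e * (u * n) + (v * n + v * n) /\
                  e * (u * n) <= e * (v * T) + (v * n + v * n))%N.
  have vn : (n <= v * n)%N by rewrite leq_pmull.
  have ve : (e * v <= v * n)%N by rewrite mulnC leq_mul2l en orbT.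
  case: TS => /(leq_mul (leqnn (e * v))) TS1 /(leq_mul (leqnn (e * v))) TS2.
  by move: up dn TS1 TS2 vn ve; clear; move=> *; split; lia.
have v0R : 0 < v%:R :> R by rewrite ltr0n.
have n0R : 0 < n%:R :> R by rewrite ltr0n.
have e0R : 0 < e%:R :> R by rewrite ltr0n.
have -> : u%:R / v%:R - T%:R / n%:R = (u%:R * n%:R - v%:R * T%:R) / (v%:R * n%:R) :> R.
  by field; rewrite ?lt0r_neq0.
rewrite normrM normfV [`|v%:R * _|]gtr0_norm ?mulr_gt0 // ler_pdivrMr ?mulr_gt0 //.
rewrite -(ler_pM2l e0R) -[X in X * `|_|](gtr0_norm e0R) -normrM.
apply: (@le_trans _ _ (2 * (v%:R * n%:R))); last first.
  rewrite [X in _ <= X]mulrA ler_wpM2r ?mulr_ge0 //.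
  by rewrite -ler_pdivrMr.
move: upT dnT; rewrite -!(ler_nat R) !natrD !natrM => upT dnT.
rewrite ler_norml mulrBr.
move: upT dnT; move: (e%:R * (u%:R * n%:R)) (e%:R * (v%:R * T%:R)) (v%:R * n%:R).
by move=> x y z; clear; move=> *; apply/andP; split; lra.
Qed.
End Density.

Lemma eq_nat_density (A A' : pred nat) u v :
  A =1 A' -> nat_density A u v -> nat_density A' u v.
Proof.
move=> AA' dA e; have [N0 HN0] := dA e; exists N0 => N /HN0.
by under eq_bigr do rewrite AA'.
Qed.

(** * The factorization of the base *)

Lemma nu_prime p a : prime p -> 0 < a -> nu p a = logn p a.
Proof.
move=> pp a0; have p1 := prime_gt1 pp.
by apply/eqP; rewrite eqn_leq -pfactor_dvdn // nuP // leqnn -nuP // pfactor_dvdnn.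
Qed.

Section Family.
Variables (r : nat) (p l : 'I_r.+1 -> nat) (k : nat).
Hypotheses (p_prime : forall i, prime (p i)) (p_inj : injective p)
  (l_gt0 : forall i, 0 < l i) (k_gt0 : 0 < k).
Hypothesis p_order : 2 <= r.+1 ->
  (forall i j : 'I_r.+1, i <= j -> l j * (p j - 1) <= l i * (p i - 1)) /\
  p ord0 = \max_(i < r.+1 | l i * (p i - 1) == l ord0 * (p ord0 - 1)) p i.

Local Notation P := (p ord0).
Local Notation L := (l ord0).
Local Notation m := (\prod_(i < r.+1 | i != ord0) p i ^ l i).

(** This set contains every n at which a prime other than P limits the power of
    b in n!, or leaves n! / b^(nu b n!) not divisible by m^k. *)
Definition deficient n :=
  [exists (i | i != ord0 :> 'I_r.+1),
     L * logn (p i) n`! < l i * (logn P n`! + L * k)].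

Lemma deficient_negligible : negligible deficient.
Proof.
apply: negligible_exists => i i0.
apply: legendre_race_negligible => //.
have r2 : 2 <= r.+1.
  by have := ltn_ord i; move: i0; rewrite -val_eqE /=; lia.
have [mono Pmax] := p_order r2; have := mono ord0 i (leq0n _).
rewrite !subn1 in Pmax *; rewrite leq_eqVlt => /orP[/eqP eq | ]; last by left.
right; split=> //; rewrite ltn_neqAle (inj_eq p_inj) i0 Pmax.
by apply: (@leq_bigmax_cond _ _ p); rewrite subn1 eq.
Qed.

Lemma coprime_cofactor : coprime P m.
Proof.
apply: (big_ind (fun x => coprime P x)) => [|x y cx cy|i i0].
- exact: coprimen1.
- by rewrite coprimeMr cx.
rewrite coprimeXr // prime_coprime // dvdn_prime2 //.
by rewrite (inj_eq p_inj) eq_sym.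
Qed.

Lemma cofactor_gt0 : 0 < m.
Proof. by apply: prodn_gt0 => i; rewrite expn_gt0 prime_gt0. Qed.

(** Dividing the bound on the valuations by L rounds v_P(n!) / L down. *)
Lemma cofactor_dvd n : ~~ deficient n -> m ^ (logn P n`! %/ L + k) %| n`!.
Proof.
move=> ok; set j := _ + k.
rewrite (big_morph (expn^~ j) (fun x y => expnMn x y j) (exp1n j)).
apply: prod_coprime_dvdn => [i i' ii' | i i0].
  rewrite !coprimeXl // !coprimeXr // prime_coprime // dvdn_prime2 //.
  by rewrite (inj_eq p_inj).
rewrite -expnM pfactor_dvdn ?fact_gt0 //.
have : l i * (logn P n`! + L * k) <= L * logn (p i) n`!.
  rewrite leqNgt; apply: contra ok => lt; apply/existsP; exists i.
  by rewrite i0.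
move=> H; rewrite -(leq_pmul2l (l_gt0 ord0)); apply: leq_trans H.
rewrite mulnCA leq_mul2l /j mulnDr leq_add2r mulnC leq_trunc_div orbT //.
Qed.

Lemma ell_fact_nat_density a c d : 0 < c -> 0 < a ->
    a < (P ^ L * m) ^ k -> ~~ (P ^ L * m %| a) -> m ^ k %| a ->
  nat_density (fun n => ell (P ^ L * m) k (c * n + d)`! == a)
    (P ^ logn P a) (L * totient (P ^ (k * L))).
Proof.
move=> c0 a0 ab ba mka.
have pP := p_prime ord0; have q0 : 0 < k * L by rewrite muln_gt0 k_gt0 l_gt0.
have al : logn P a < L.
  rewrite ltnNge -pfactor_dvdn //; apply: contra ba => Pa.
  rewrite Gauss_dvd ?Pa ?coprimeXl ?coprime_cofactor //.
  by apply: dvdn_trans mka; rewrite -{1}(expn1 m) dvdn_exp2l.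
set q := P ^ (k * L).
(* The factor 2 makes the modulus N' L of the valuations at least 2, where 'Z_n
   is the ring of integers modulo n. *)
pose N' := totient q * 2.
have tq : 0 < totient q by rewrite totient_gt0 expn_gt0 prime_gt0.
have N'1 : 1 < N' by rewrite /N'; lia.
have mN' : m ^ N' = 1 %[mod q].
  rewrite /N' expnM -modnXm Euler_exp_totient ?modnXm ?exp1n //.
  by rewrite coprime_sym coprimeXl // coprime_cofactor.
have N1 : 1 < N' * L by apply: leq_trans N'1 _; rewrite leq_pmulr.
apply: (@nat_density_perturb _ (fun n =>
  local_class P (k * L) (N' * L) (c * n + d)`! \in ell_classes P L m k N' a)
  _ _ _ _ (negligible_progression d c0 deficient_negligible)).
  move=> n ok; rewrite mem_ell_classes ?fact_gt0 //.
  by rewrite ell_eqE ?fact_gt0 ?mka ?coprime_cofactor ?cofactor_gt0 ?cofactor_dvd.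
move=> e.
have [N0 HN0] := @fact_equidistributed _ P (k * L)
  (local_class P (k * L) (N' * L)) (@local_class_commute _ _ _)
  (prime_gt1 pP) (@local_classM _ _ _ pP q0) (@local_class_mod _ _ _ pP q0 N1)
  (local_class_surj pP q0 N1) c c0 d e (ell_classes P L m k N' a).
exists N0 => N /HN0;
  rewrite card_local_classes // card_ell_classes ?coprime_cofactor ?cofactor_gt0 //.
set S := \sum_(0 <= n < N) _; rewrite -/q; move: (totient q) => t.
have N'0 : 0 < N' by exact: ltnW.
have NN : N <= N' * N by rewrite leq_pmull.
case=> up dn; split; rewrite -(leq_pmul2l N'0); move: up dn NN.
  by move: (P ^ logn P a) (S) (N'); clear=> *; lia.
by move: (P ^ logn P a) (S) (N'); clear=> *; lia.
Qed.

Lemma ell_fact_density_zero a c d : 0 < c ->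
    a < (P ^ L * m) ^ k -> ~~ (m ^ k %| a) ->
  nat_density (fun n => ell (P ^ L * m) k (c * n + d)`! == a) 0 1.
Proof.
move=> c0 ab mka.
apply: (@nat_density_perturb _ xpred0
  _ _ _ _ (negligible_progression d c0 deficient_negligible)); last first.
  by move=> e; exists 0 => N _; rewrite big1 // !(muln0, mul0n).
move=> n ok; rewrite ell_eqE ?fact_gt0 ?(negbTE mka) //.
- exact: coprime_cofactor.
- exact: cofactor_gt0.
- exact: cofactor_dvd.
Qed.
End Family.

Local Close Scope nat_scope.
Local Open Scope classical_set_scope.
Local Open Scope ring_scope.

Lemma frequency_formula (R : realType) p l k g : prime p -> (0 < l)%N -> (0 < k)%N ->
  (p ^ g)%:R / (l * totient (p ^ (k * l)))%:R
  = 1 / ((p - 1) * l)%:R * p%:R ^ (g%:Z - (k * l)%:Z + 1) :> R.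
Proof.
move=> pp l0 k0; have kl0 : (0 < k * l)%N by rewrite muln_gt0 k0.
have pR : p%:R != 0 :> R by rewrite pnatr_eq0 -lt0n prime_gt0.
rewrite totient_pfactor // subn1.
have -> : (g%:Z - (k * l)%:Z + 1 = g%:Z - (k * l).-1%:Z)%R by lia.
rewrite expfzDr // -invr_expz -!exprnP mulnA !natrM !natrX.
have l0R : l%:R != 0 :> R by rewrite pnatr_eq0 -lt0n.
have p1R : p.-1%:R != 0 :> R by rewrite pnatr_eq0 -lt0n; have := prime_gt1 pp; lia.
by move: (p.-1%:R : R) p1R => u u0; field; rewrite ?expf_neq0 ?u0 ?l0R.
Qed.

(* The r + 1 primes p_1, ..., p_(r+1) are p 0, ..., p r; p_1 is [p ord0]. *)
Theorem theorem2 (R : realType) (b k r : nat) (p l : 'I_r.+1 -> nat) (a : nat)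
    (hb : (2 <= b)%N) (hk : (1 <= k)%N)
    (p_prime : forall i, prime (p i)) (p_inj : injective p)
    (l_gt0 : forall i, (0 < l i)%N)
    (b_fact : b = (\prod_(i < r.+1) p i ^ l i)%N)
    (p_order : (2 <= r.+1)%N ->
       (forall i j : 'I_r.+1, (i <= j)%N ->
          (l j * (p j - 1) <= l i * (p i - 1))%N) /\
       p ord0 = (\max_(i < r.+1 | l i * (p i - 1) == l ord0 * (p ord0 - 1)) p i)%N)
    (ha : (1 <= a <= b ^ k - 1)%N) (ba : ~~ (b %| a)%N) :
  exists f : R,
    [/\ has_density [pred n | ell b k n`! == a] f,
        ((b %/ p ord0 ^ l ord0) ^ k %| a)%N ->
          f = 1 / ((p ord0 - 1) * l ord0)%:R
              * (p ord0)%:R ^ ((nu (p ord0) a)%:Z - (k * l ord0)%:Z + 1),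
        ~~ ((b %/ p ord0 ^ l ord0) ^ k %| a)%N -> f = 0
      & forall c d : nat, (1 <= c)%N ->
          has_density [pred n | ell b k (c * n + d)`! == a] f].
Proof.
have pP := p_prime ord0; have P0 := prime_gt0 pP.
have [a0 ab] : (0 < a /\ a < b ^ k)%N.
  by case/andP: ha => a0 ab; split=> //; have := expn_gt0 b k; lia.
rewrite (bigD1 ord0) //= in b_fact.
have -> : (b %/ p ord0 ^ l ord0 = \prod_(i < r.+1 | i != ord0) p i ^ l i)%N.
  by rewrite b_fact mulKn // expn_gt0 P0.
rewrite nu_prime // -frequency_formula //.
set m := (\prod_(i < r.+1 | _) _)%N; set P := p ord0; set L := l ord0.
set v := (L * totient (P ^ (k * L)))%N.
have v0 : (0 < v)%N by rewrite muln_gt0 l_gt0 totient_gt0 expn_gt0 P0.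
pose u := (if m ^ k %| a then P ^ logn P a else 0)%N.
have dens c d : (1 <= c)%N ->
    nat_density (fun n => ell b k (c * n + d)`! == a) u v.
  rewrite /u b_fact => c0; rewrite b_fact in ab ba.
  case: ifP => [mka | /negbT mka]; first exact: ell_fact_nat_density.
  have := ell_fact_density_zero p_prime p_inj l_gt0 hk p_order d c0 ab mka.
  move=> d01 e; have [N0 HN0] := d01 (e * v)%N; exists N0 => N /HN0.
  by rewrite mul1n !mul0n !muln0 !mulnA.
have hdens c d : (1 <= c)%N ->
    has_density [pred n | ell b k (c * n + d)`! == a] (u%:R / v%:R : R).
  by move=> c0; apply: nat_density_has_density => //; exact: dens.
exists (u%:R / v%:R); split=> //.
- apply: nat_density_has_density => //.
  by apply: eq_nat_density (dens 1%N 0%N isT) => n; rewrite mul1n addn0.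
- by rewrite /u => ->.
- by rewrite /u => /negbTE ->; rewrite mul0r.
Qed.
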